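(* Let $G$ be a connected graph with minimum degree $\delta$. Then, for any $\alpha\in[0,1]$, $$\lambda_1(B_\alpha(G))\ge\alpha\,\delta.$$
   Context: All graphs are simple and undirected, with a finite vertex set. $A(G)$ is the adjacency matrix, $D(G)$ the diagonal matrix of vertex degrees, and $L(G)=D(G)-A(G)$ the Laplacian matrix of $G$. For $\alpha\in[0,1]$, $B_\alpha(G):=\alpha A(G)+(1-\alpha)L(G)$. $\lambda_1(S)$ denotes the largest eigenvalue of a real symmetric matrix $S$. *)

(* Defs.v *)
From HB Require Import structures.
From mathcomp Require Import all_boot all_order all_algebra.
From mathcomp Require Import all_classical all_reals.

Set Implicit Arguments.
Unset Strict Implicit.
Unset Printing Implicit Defensive.

Import Order.TTheory GRing.Theory Num.Theory.

Local Open Scope classical_set_scope.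
Local Open Scope ring_scope.

Definition simple_graph (T : finType) (e : rel T) : Prop :=
  symmetric e /\ irreflexive e.

(* A connected graph is required to have at least one vertex. *)
Definition connected_graph (T : finType) (e : rel T) : Prop :=
  (0 < #|T|)%N /\ forall x y : T, connect e x y.

Definition degree (T : finType) (e : rel T) (x : T) : nat :=
  #|[set y : T | e x y]%SET|.

(* Degrees in a simple graph are smaller than #|T|, so when T is nonempty the
   initial value #|T| does not affect the minimum. *)
Definition min_degree (T : finType) (e : rel T) : nat :=
  \big[minn/#|T|]_(x : T) degree e x.

(* Vertices index rows and columns through the enumeration enum_val of T. *)
Definition adj_mx (R : realType) (T : finType) (e : rel T) : 'M[R]_#|T| :=
  \matrix_(i, j) (e (enum_val i) (enum_val j))%:R.

Definition degree_mx (R : realType) (T : finType) (e : rel T) : 'M[R]_#|T| :=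
  diag_mx (\row_i (degree e (enum_val i))%:R).

Definition laplacian_mx (R : realType) (T : finType) (e : rel T) :
    'M[R]_#|T| :=
  degree_mx R e - adj_mx R e.

Definition B_mx (R : realType) (T : finType) (e : rel T) (alpha : R) :
    'M[R]_#|T| :=
  alpha *: adj_mx R e + (1 - alpha) *: laplacian_mx R e.

(* The greatest element of the set of eigenvalues. A symmetric matrix of
   positive size over R has one, so the default value 0 is then not used. *)
Definition lambda1 (R : realType) (n : nat) (S : 'M[R]_n) : R :=
  xget 0 [set a | eigenvalue S a /\ forall b : R, eigenvalue S b -> b <= a].

(* Main.v *)
Require Import Defs.
From mathcomp Require Import all_boot all_order all_algebra.
From mathcomp Require Import all_classical all_reals.
From mathcomp Require Import complex.

Import Order.TTheory GRing.Theory Num.Theory.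
Local Open Scope ring_scope.

(** Each row of the Laplacian sums to zero, and each row of the adjacency matrix
sums to the degree of its vertex. Hence, writing 1 for the all-ones vector, the
quadratic form of [B_mx e alpha] at 1 is alpha times the sum of the degrees, which
is at least alpha * min_degree * #|T|, while 1 has squared norm #|T|. The
Rayleigh quotient at 1 is thus at least alpha * min_degree, and the Rayleigh
quotients of a real symmetric matrix are at most its largest eigenvalue
([rayleigh_le_lambda1]).

The Rayleigh bound comes from the unitary diagonalization of Hermitian matrices
over the complex numbers R[i]: a real symmetric matrix becomes Hermitian there, its
diagonal form is real, and in the diagonalizing coordinates the quadratic form
is a combination of squared moduli weighted by the eigenvalues
([rayleigh_max]). *)

(** * The Rayleigh principle for real symmetric matrices *)

Section Rayleigh.
Import Num.Def.
Local Open Scope sesquilinear_scope.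

Lemma map_real_complex_real (R : rcfType) m n (A : 'M[R]_(m, n)) :
  map_mx (real_complex R) A \is a realmx.
Proof. by apply/mxOverP=> i j; rewrite mxE complex_real. Qed.

Lemma diag_mx_form (C : numClosedFieldType) n (d w : 'rV[C]_n) :
  (w *m diag_mx d *m w^t*) 0 0 = \sum_i d 0 i * `|w 0 i| ^+ 2.
Proof.
rewrite mul_mx_diag mxE; apply: eq_bigr => i _.
by rewrite !mxE normCK mulrA [d 0 i * _]mulrC.
Qed.

Lemma dot_form (R : realDomainType) n (v : 'rV[R]_n) :
  (v *m v^T) 0 0 = \sum_i v 0 i ^+ 2.
Proof. by rewrite mxE; apply: eq_bigr => i _; rewrite mxE -expr2. Qed.

(** Expanding v in an orthonormal eigenbasis, the form at v is the sum of
d i * |w i| ^ 2, at most (max d) times the sum of |w i| ^ 2, which is the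
squared norm of v. The basis is taken over R[i], but the eigenvalues are real, and
being an eigenvalue descends from R[i] to R since it is being a root of the
characteristic polynomial. The single bound m serves twice below: it also
dominates every eigenvalue, hence is the largest one. *)
Lemma rayleigh_max (R : rcfType) n (S : 'M[R]_n) : (0 < n)%N -> S^T = S ->
  exists2 m : R, eigenvalue S m
    & forall v : 'rV_n, (v *m S *m v^T) 0 0 <= m * (v *m v^T) 0 0.
Proof.
move=> n_gt0 symS; pose toC := real_complex R; pose Sc := map_mx toC S.
have hermSc : Sc \is hermsymmx.
  apply: realsym_hermsym; last exact: map_real_complex_real.
  apply/is_hermitianmxP; rewrite expr0 scale1r map_mx_id //.
  by rewrite /Sc map_trmx symS.
pose P := spectralmx Sc.
have uP : P \is unitarymx := spectral_unitarymx Sc.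
have ScE : Sc = P^t* *m diag_mx (spectral_diag Sc) *m P.
  by rewrite -invmx_unitary //; apply/orthomx_spectralP/hermitian_normalmx.
have /mxOverP real_d := hermitian_spectral_diag_real hermSc.
pose d i : R := complex.Re (spectral_diag Sc 0 i).
have dE i : spectral_diag Sc 0 i = toC (d i) by rewrite /toC /d RRe_real.
(* The rows of P are eigenvectors of Sc, nonzero because they have norm 1. *)
have eigd i : eigenvalue S (d i).
  rewrite -(eigenvalue_map toC); apply/eigenvalueP; exists (row i P).
    rewrite -row_mul -/Sc ScE !mulmxA (unitarymxP uP) mul1mx.
    by rewrite row_mul row_diag_mx -scalemxAl -rowE dE.
  apply/eqP=> Pi0; have /row_unitarymxP/(_ i i) := uP.
  by rewrite Pi0 linear0l eqxx => /esym/eqP; rewrite oner_eq0.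
pose k := [arg max_(i > Ordinal n_gt0) d i]%O.
have dk i : d i <= d k.
  by rewrite /k; case: Order.TotalTheory.arg_maxP => // j _; apply.
(* w holds the coordinates of v in the basis formed by the rows of P. *)
exists (d k) => // v; pose vc := map_mx toC v; pose w := vc *m P^t*.
have wE : w^t* = P *m vc^T.
  rewrite trmx_mul map_mxM -[map_mx _ (P^t*)^T]/(P^t*^t*) trmxCK.
  by rewrite -map_trmx realmxC ?map_real_complex_real.
have toC_vSv : toC ((v *m S *m v^T) 0 0) = \sum_i toC (d i) * `|w 0 i| ^+ 2.
  transitivity ((w *m diag_mx (spectral_diag Sc) *m w^t*) 0 0).
    rewrite wE /w !mulmxA -(mulmxA vc) -(mulmxA vc) -ScE.
    by rewrite map_trmx -!map_mxM [RHS]mxE.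
  by rewrite diag_mx_form; apply: eq_bigr => i _; rewrite dE.
have toC_vv : toC ((v *m v^T) 0 0) = \sum_i `|w 0 i| ^+ 2.
  transitivity ((w *m w^t*) 0 0).
    rewrite wE /w mulmxA -(mulmxA vc).
    have -> : P^t* *m P = 1%:M by rewrite -invmx_unitary ?mulVmx ?unitarymx_unit.
    by rewrite mulmx1 map_trmx -map_mxM [RHS]mxE.
  by rewrite mxE; apply: eq_bigr => i _; rewrite !mxE normCK.
have le_sum : toC ((v *m S *m v^T) 0 0) <= toC (d k) * toC ((v *m v^T) 0 0).
  rewrite toC_vSv toC_vv mulr_sumr; apply: ler_sum => i _.
  by apply: ler_wpM2r; rewrite ?exprn_ge0 // lecR.
by rewrite -lecR; apply: le_trans le_sum _; rewrite -rmorphM.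
Qed.

End Rayleigh.

(** Applied to an eigenvector, the bound of [rayleigh_max] shows that m is the
greatest eigenvalue; so the set whose element [lambda1] picks is inhabited, and
the picked element dominates m. *)
Lemma rayleigh_le_lambda1 (R : realType) n (S : 'M[R]_n) (v : 'rV_n) :
  (0 < n)%N -> S^T = S ->
  (v *m S *m v^T) 0 0 <= lambda1 S * (v *m v^T) 0 0.
Proof.
move=> n_gt0 symS; have [m eigm rayS] := rayleigh_max _ _ _ n_gt0 symS.
have dot_ge0 (u : 'rV[R]_n) : 0 <= (u *m u^T) 0 0.
  by rewrite dot_form sumr_ge0 // => i _; rewrite sqr_ge0.
have /(xgetPex 0) [_ /(_ m eigm) le_m] :
    exists a, eigenvalue S a /\ forall b, eigenvalue S b -> b <= a.
  exists m; split=> // b /eigenvalueP[u uS u_neq0].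
  have := rayS u; rewrite uS -scalemxAl mxE ler_pM2r //.
  rewrite lt_neqAle dot_ge0 andbT eq_sym; apply: contra u_neq0 => /eqP.
  rewrite dot_form => /psumr_eq0P u0; apply/eqP/rowP => i; rewrite mxE.
  by apply/eqP; rewrite -sqrf_eq0 u0 // => j _; rewrite sqr_ge0.
exact: le_trans (rayS v) (ler_wpM2r _ le_m).
Qed.

(** * The quadratic form of [B_mx] at the all-ones vector *)

Lemma B_mx_sym (R : realType) (T : finType) (e : rel T) (alpha : R) :
  symmetric e -> (B_mx e alpha)^T = B_mx e alpha.
Proof.
move=> e_sym; have adj_sym : (adj_mx R e)^T = adj_mx R e.
  by apply/matrixP => i j; rewrite !mxE e_sym.
have lap_sym : (laplacian_mx R e)^T = laplacian_mx R e.
  by rewrite [LHS]linearB /= adj_sym tr_diag_mx.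
by rewrite [LHS]linearD /= !linearZ /= adj_sym lap_sym.
Qed.

Lemma adj_mx_row_sum (R : realType) (T : finType) (e : rel T) i :
  \sum_j adj_mx R e i j = (degree e (enum_val i))%:R.
Proof.
under eq_bigr => j _ do rewrite mxE.
rewrite -(big_enum_val (fun y => (e (enum_val i) y)%:R)) /=.
rewrite -natr_sum; congr (_%:R).
rewrite /degree -sum1_card [RHS]big_mkcond /=; apply: eq_bigr => y _.
by rewrite inE; case: (e _ y).
Qed.

(** Only the adjacency part contributes, the Laplacian having zero row sums;
the all-ones vector is therefore a convenient test vector. *)
Lemma B_mx_row_sum (R : realType) (T : finType) (e : rel T) (alpha : R) i :
  \sum_j B_mx e alpha i j = alpha * (degree e (enum_val i))%:R.
Proof.
have degsum : \sum_j degree_mx R e i j = (degree e (enum_val i))%:R.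
  rewrite (bigD1 i) //= big1 ?addr0 => [|j ji]; first by rewrite !mxE eqxx.
  by rewrite !mxE eq_sym (negbTE ji).
transitivity (alpha * (\sum_j adj_mx R e i j) + (1 - alpha) *
    (\sum_j degree_mx R e i j - \sum_j adj_mx R e i j)).
  by rewrite -sumrB !mulr_sumr -big_split; apply: eq_bigr => j _; rewrite !mxE.
by rewrite degsum adj_mx_row_sum subrr mulr0 addr0.
Qed.

Lemma min_degree_le (T : finType) (e : rel T) x :
  (min_degree e <= degree e x)%N.
Proof. by rewrite /min_degree -minEnat -leEnat bigmin_le. Qed.

Theorem theorem4p2 (R : realType) (T : finType) (e : rel T)
    (e_simple : simple_graph e) (e_connected : connected_graph e)
    (alpha : R) (alpha_ge0 : 0 <= alpha) (alpha_le1 : alpha <= 1) :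
  alpha * (min_degree e)%:R <= lambda1 (B_mx e alpha).
Proof.
have [e_sym _] := e_simple; have [T_gt0 _] := e_connected.
pose ones : 'rV[R]_#|T| := const_mx 1.
have /(rayleigh_le_lambda1 _ _ _ ones T_gt0) := B_mx_sym _ _ e alpha e_sym.
have -> : (ones *m ones^T) 0 0 = #|T|%:R.
  rewrite dot_form; under eq_bigr do rewrite mxE expr1n.
  by rewrite sumr_const card_ord.
have -> : (ones *m B_mx e alpha *m ones^T) 0 0
    = \sum_(i < #|T|) alpha * (degree e (enum_val i))%:R.
  rewrite -mulmxA mxE; apply: eq_bigr => i _.
  rewrite mxE mul1r -B_mx_row_sum mxE.
  by apply: eq_bigr => j _; rewrite !mxE mulr1.
move=> le_lambda1; rewrite -(ler_pM2r (x := #|T|%:R)) ?ltr0n //.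
apply: le_trans le_lambda1.
rewrite mulr_natr -[in leLHS](card_ord #|T|) -sumr_const.
apply: ler_sum => i _; apply: ler_wpM2l => //.
by rewrite ler_nat min_degree_le.
Qed.
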